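(* Let $\alpha>1$ and consider the power-law family $f_a(x)=-|x|^{\alpha}+a$, $a\in\mathbb{R}$. There exists a unique parameter $a=a(\alpha)$ for which the kneading sequence of $f_a$ is $RLRRRLRC$, i.e. $f_a(0)>0$, $f_a^2(0)<0$, $f_a^3(0)>0$, $f_a^4(0)>0$, $f_a^5(0)>0$, $f_a^6(0)<0$, $f_a^7(0)>0$ and $f_a^8(0)=0$.
   Context: The kneading sequence lists, for $n=1,2,\dots$, the symbol $R$, $L$ or $C$ according as $f_a^n(0)>0$, $<0$ or $=0$, terminating at the first $C$. The sequence $RLRRRLRC$ corresponds to a super-attracting periodic orbit of period $8$. *)

(* Defs.v *)
From Stdlib Require Import Reals.
Open Scope R_scope.

(* |x|^alpha for real alpha > 0, with the convention 0^alpha = 0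
   (Stdlib's Rpower 0 alpha = exp(alpha * ln 0) = 1, so we special-case 0). *)
Definition abs_pow (x alpha : R) : R :=
  if Req_EM_T x 0 then 0 else Rpower (Rabs x) alpha.

Definition f (alpha a x : R) : R := - abs_pow x alpha + a.

Fixpoint iter_f (alpha a : R) (n : nat) (x : R) : R :=
  match n with
  | O => x
  | S k => f alpha a (iter_f alpha a k x)
  end.

Definition kneading_RLRRRLRC (alpha a : R) : Prop :=
  iter_f alpha a 1 0 > 0 /\ iter_f alpha a 2 0 < 0 /\ iter_f alpha a 3 0 > 0 /\
  iter_f alpha a 4 0 > 0 /\ iter_f alpha a 5 0 > 0 /\ iter_f alpha a 6 0 < 0 /\
  iter_f alpha a 7 0 > 0 /\ iter_f alpha a 8 0 = 0.

(* Main.v *)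
(* Pulling [x_8 = 0] back along the kneading sequence turns the problem into the
   fixed-point equation [x1(a) = a], where [x7 = a^(1/alpha)],
   [|x6| = (a - x7)^(1/alpha)], ..., on the domain [x5(a) < a] with [a > 1].
   Uniqueness follows once [x1' < 1] at every fixed point. With [ki] the inverse
   slope of [f] at [xi], the chain rule gives [1 - x1' = A - k1 k2 k3 k4 B], where
   [A = 1 - k1 - k1 k2 (1 - k3)] and [B = 1 - k5 - k5 k6 (1 - k7) = 1 - x5'].
   The order of the orbit gives [A > B]; the period-4 return satisfies [B > 0] on
   the whole domain (which is therefore an up-closed set); and
   [k1 k2 k3 k4 <= 1], i.e. [|(f^4)'(x1)| >= 1], by comparing the factors of the
   derivative with chord slopes between the orbits of [x1] and [x5]. *)
Require Import Defs.
From Stdlib Require Import Reals Lra Psatz Ranalysis5.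
Open Scope R_scope.

(** * Real powers, logarithms and convexity *)

Lemma Rpower_pos (x y : R) : 0 < Rpower x y.
Proof. apply exp_pos. Qed.

Lemma Rpower_1_base (y : R) : Rpower 1 y = 1.
Proof. unfold Rpower. now rewrite ln_1, Rmult_0_r, exp_0. Qed.

Lemma Rpower_invK (alpha x : R) :
  0 < alpha -> 0 < x -> Rpower (Rpower x (/ alpha)) alpha = x.
Proof.
intros Ha Hx. rewrite Rpower_mult, Rinv_l by lra. now apply Rpower_1.
Qed.

Lemma RpowerK_inv (alpha x : R) :
  0 < alpha -> 0 < x -> Rpower (Rpower x alpha) (/ alpha) = x.
Proof.
intros Ha Hx. rewrite Rpower_mult, Rinv_r by lra. now apply Rpower_1.
Qed.

Lemma Rpower_lt_cancel (c x y : R) :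
  0 < c -> 0 < x -> 0 < y -> Rpower x c < Rpower y c -> x < y.
Proof.
intros Hc Hx Hy H. destruct (Rlt_or_le x y) as [|Hyx]; [assumption|].
pose proof (Rle_Rpower_l y x c ltac:(lra) ltac:(lra)). lra.
Qed.

Lemma Rpower_pred (x c : R) : 0 < x -> Rpower x (c - 1) = Rpower x c / x.
Proof.
intros Hx. unfold Rminus.
rewrite Rpower_plus, Rpower_Ropp, Rpower_1 by assumption. reflexivity.
Qed.

Lemma Rdiv_lt_1 (x y : R) : 0 < y -> x < y -> x / y < 1.
Proof.
intros Hy Hxy. apply Rmult_lt_reg_r with y; [assumption|].
replace (x / y * y) with x by (field; lra). lra.
Qed.

Lemma Rdiv_le_1 (x y : R) : 0 < y -> x <= y -> x / y <= 1.
Proof.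
intros Hy [H|<-]; [left; now apply Rdiv_lt_1 | right; field; lra].
Qed.

Lemma ln_le_pred (x : R) : 0 < x -> ln x <= x - 1.
Proof.
intros Hx. pose proof (exp_ineq1_le (ln x)) as H.
rewrite exp_ln in H by assumption. lra.
Qed.

Lemma ln_quot (x y : R) : 0 < x -> 0 < y -> ln (x / y) = ln x - ln y.
Proof.
intros Hx Hy. unfold Rdiv.
rewrite ln_mult, ln_Rinv by (assumption || now apply Rinv_0_lt_compat). ring.
Qed.

Lemma Rpower_bernoulli_concave (b z : R) :
  0 < b < 1 -> 0 < z -> Rpower z b <= 1 + b * (z - 1).
Proof.
intros Hb Hz. unfold Rpower. set (L := ln z).
assert (HzL : z = exp L) by (unfold L; now rewrite exp_ln).
(* Tangent to [exp] at [b L], evaluated at [L] and at [0]. *)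
assert (H1 : exp (b * L) * (1 + (1 - b) * L) <= z).
{ rewrite HzL. replace (exp L) with (exp (b * L) * exp ((1 - b) * L)).
  - apply Rmult_le_compat_l; [left; apply exp_pos | apply exp_ineq1_le].
  - rewrite <- exp_plus. f_equal. ring. }
assert (H2 : exp (b * L) * (1 + - (b * L)) <= 1).
{ replace 1 with (exp (b * L) * exp (- (b * L))) at 2.
  - apply Rmult_le_compat_l; [left; apply exp_pos | apply exp_ineq1_le].
  - rewrite <- exp_plus, Rplus_opp_r. apply exp_0. }
(* Weighting [H1] by [b] and [H2] by [1 - b] cancels the terms in [L]. *)
nra.
Qed.

Lemma inv_lt_1 (alpha : R) : 1 < alpha -> 0 < / alpha < 1.
Proof.
intros H. split; [apply Rinv_0_lt_compat; lra|].
rewrite <- Rinv_1. apply Rinv_lt_contravar; lra.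
Qed.

(** Bernoulli's inequality for the exponent [/ alpha], taken at [Rpower (x / y) alpha], is the
    tangent inequality at 1; homogeneity moves the point of tangency to [y]. *)
Lemma Rpower_tangent_convex (alpha x y : R) :
  1 < alpha -> 0 < x -> 0 < y ->
  Rpower y alpha + alpha * Rpower y (alpha - 1) * (x - y) <= Rpower x alpha.
Proof.
intros Ha Hx Hy.
assert (Hxy : 0 < x / y) by now apply Rdiv_lt_0_compat.
pose proof (Rpower_bernoulli_concave (/ alpha) (Rpower (x / y) alpha)
  (inv_lt_1 _ Ha) (Rpower_pos _ _)) as H.
rewrite RpowerK_inv in H by lra.
assert (H' : 1 + alpha * (x / y - 1) <= Rpower (x / y) alpha).
{ apply (Rmult_le_compat_l alpha) in H; [|lra].
  replace (alpha * (1 + / alpha * (Rpower (x / y) alpha - 1)))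
    with (alpha + Rpower (x / y) alpha - 1) in H by (field; lra). lra. }
rewrite Rpower_pred by assumption.
replace (Rpower x alpha) with (Rpower y alpha * Rpower (x / y) alpha)
  by (rewrite Rpower_mult_distr by assumption; f_equal; field; lra).
replace (Rpower y alpha + alpha * (Rpower y alpha / y) * (x - y))
  with (Rpower y alpha * (1 + alpha * (x / y - 1))) by (field; lra).
apply Rmult_le_compat_l; [left; apply Rpower_pos | exact H'].
Qed.

(** * Transversality inequalities *)

(* [1 / |f'(x)|] for [x > 0]. *)
Definition inv_slope (alpha x : R) : R := / alpha * Rpower x (1 - alpha).

Lemma inv_slope_pos (alpha x : R) : 0 < alpha -> 0 < inv_slope alpha x.
Proof.
intros Ha. apply Rmult_lt_0_compat; [now apply Rinv_0_lt_compat | apply Rpower_pos].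
Qed.

Lemma inv_slopeE (alpha x : R) :
  0 < alpha -> 0 < x -> inv_slope alpha x = x / (alpha * Rpower x alpha).
Proof.
intros Ha Hx. unfold inv_slope, Rminus.
rewrite Rpower_plus, Rpower_1, Rpower_Ropp by assumption.
pose proof (Rpower_pos x alpha). field. lra.
Qed.

Lemma inv_slope_inv (alpha x : R) :
  0 < alpha -> inv_slope alpha x = / (alpha * Rpower x (alpha - 1)).
Proof.
intros Ha. unfold inv_slope.
replace (1 - alpha) with (- (alpha - 1)) by ring.
rewrite Rpower_Ropp. pose proof (Rpower_pos x (alpha - 1)). field. lra.
Qed.

Lemma inv_slope_decr (alpha x y : R) :
  1 < alpha -> 0 < x < y -> inv_slope alpha y < inv_slope alpha x.
Proof.
intros Ha Hxy. rewrite !inv_slope_inv by lra.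
pose proof (Rpower_pos x (alpha - 1)).
pose proof (Rlt_Rpower_l x y (alpha - 1) ltac:(lra) Hxy).
apply Rinv_lt_contravar.
- pose proof (Rpower_pos y (alpha - 1)). repeat apply Rmult_lt_0_compat; lra.
- apply Rmult_lt_compat_l; lra.
Qed.

(* Positive transversality of the period-4 return: with [t = x7/a] and
   [u = w/a], the hypothesis [x5 < a] reads [- ln t > ln (1 + u) / alpha]. *)
Lemma return4_slope_lt_1 (alpha a x7 w x5 : R) :
  1 < alpha -> 0 < a -> 0 < x7 -> 0 < w -> 0 < x5 ->
  Rpower x7 alpha = a -> Rpower w alpha = a - x7 -> Rpower x5 alpha = a + w ->
  x5 < a ->
  inv_slope alpha x5 * (1 + inv_slope alpha w * (1 - inv_slope alpha x7)) < 1.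
Proof.
intros Hal Ha H7 Hw H5 E7 Ew E5 Hlt.
pose proof (Rpower_pos w alpha) as Hd. rewrite Ew in Hd.
rewrite !inv_slopeE, E7, Ew, E5 by lra.
(* The chain is [w / (a + w) <= ln ((a + w) / a) < alpha * ln (a / x7) <= alpha * (a / x7 - 1)]; its
   middle step is [x5 < a]. *)
assert (Hkey : w * x7 < alpha * (a - x7) * (a + w)).
{ assert (L7 : alpha * ln x7 = ln a) by (rewrite <- E7; unfold Rpower; now rewrite ln_exp).
  assert (L5 : alpha * ln x5 = ln (a + w)) by (rewrite <- E5; unfold Rpower; now rewrite ln_exp).
  pose proof (ln_increasing x5 a H5 Hlt) as L.
  assert (Ha7 : 0 < a / x7) by (apply Rdiv_lt_0_compat; lra).
  assert (Haw : 0 < a / (a + w)) by (apply Rdiv_lt_0_compat; lra).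
  pose proof (ln_le_pred _ Ha7) as M1. pose proof (ln_le_pred _ Haw) as M2.
  rewrite ln_quot in M1, M2 by lra.
  assert (M3 : 1 - a / (a + w) < alpha * (a / x7 - 1)) by nra.
  replace (1 - a / (a + w)) with (w / (a + w)) in M3 by (field; lra).
  apply (Rmult_lt_compat_r (x7 * (a + w))) in M3; [|nra].
  replace (w / (a + w) * (x7 * (a + w))) with (w * x7) in M3 by (field; lra).
  replace (alpha * (a / x7 - 1) * (x7 * (a + w)))
    with (alpha * (a - x7) * (a + w)) in M3 by (field; lra).
  exact M3. }
set (d := a - x7) in *. replace x7 with (a - d) in * by (unfold d; ring).
clearbody d.
assert (Hbr : 0 < alpha * alpha * d * a + w * (alpha * a - (a - d))).
{ assert (0 < (alpha - 1) * a) by nra.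
  assert (0 < w * ((alpha - 1) * a + d)) by (apply Rmult_lt_0_compat; lra).
  assert (0 < alpha * alpha * d * a) by (repeat apply Rmult_lt_0_compat; lra). nra. }
replace (x5 / (alpha * (a + w)) *
  (1 + w / (alpha * d) * (1 - (a - d) / (alpha * a))))
  with (x5 / a * ((alpha * alpha * d * a + w * (alpha * a - (a - d)))
         / (alpha * alpha * alpha * (a + w) * d))) by (field; repeat split; lra).
assert (Hden : 0 < alpha * alpha * alpha * (a + w) * d)
  by (repeat apply Rmult_lt_0_compat; lra).
assert (H1 : x5 / a < 1) by (apply Rdiv_lt_1; lra).
assert (H0 : 0 < x5 / a) by (apply Rdiv_lt_0_compat; lra).
assert (H2 : (alpha * alpha * d * a + w * (alpha * a - (a - d)))
         / (alpha * alpha * alpha * (a + w) * d) <= 1).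
{ apply Rdiv_le_1; [assumption|].
  (* Denominator minus numerator is divisible by [alpha - 1]; in the cofactor only the first bracket
     has no evident sign, and [Hkey] makes it positive. *)
  assert (E : alpha * alpha * alpha * (a + w) * d
            - (alpha * alpha * d * a + w * (alpha * a - (a - d)))
    = (alpha - 1) * ((alpha * d * (a + w) - w * (a - d))
       + alpha * (alpha - 1) * (a * d) + alpha * alpha * (w * d))) by ring.
  assert (0 < a * d) by nra. assert (0 < w * d) by nra.
  assert (0 < alpha * (alpha - 1)) by nra. assert (0 < alpha * alpha) by nra.
  assert (0 < alpha * (alpha - 1) * (a * d)) by nra.
  assert (0 < alpha * alpha * (w * d)) by nra.
  assert (0 < (alpha - 1) * ((alpha * d * (a + w) - w * (a - d))
       + alpha * (alpha - 1) * (a * d) + alpha * alpha * (w * d)))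
    by (apply Rmult_lt_0_compat; lra).
  lra. }
assert (H3 : 0 < (alpha * alpha * d * a + w * (alpha * a - (a - d)))
         / (alpha * alpha * alpha * (a + w) * d))
  by (apply Rdiv_lt_0_compat; lra).
nra.
Qed.

(** The function [psi] below is nondecreasing on [[0, L]]: its derivative is nonnegative at [s] when
    [(1 - / alpha) * s <= ln alpha], which holds for [s <= 1] because [ln alpha >= 1 - / alpha]. *)
Lemma expm1_scaled_ge (alpha L : R) :
  1 < alpha -> 0 < L <= 1 ->
  exp L - 1 <= alpha * alpha * (exp (L / alpha) - 1).
Proof.
intros Hal HL.
set (psi := fun s => alpha * alpha * exp (/ alpha * s) - exp s).
assert (Hd : forall c, 0 <= c <= L ->
  derivable_pt_lim psi c (alpha * exp (/ alpha * c) - exp c)).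
{ intros c _. unfold psi.
  replace (alpha * exp (/ alpha * c) - exp c)
    with (alpha * alpha * (exp (/ alpha * c) * (/ alpha * 1)) - exp c) by (field; lra).
  apply derivable_pt_lim_minus; [|apply derivable_pt_lim_exp].
  apply (derivable_pt_lim_scal (fun s => exp (/ alpha * s))).
  apply (derivable_pt_lim_comp (fun s => / alpha * s) exp).
  - apply (derivable_pt_lim_scal (fun s => s)). apply derivable_pt_lim_id.
  - apply derivable_pt_lim_exp. }
destruct (MVT_cor2 psi _ 0 L ltac:(lra) Hd) as [c [E Hc]].
assert (Hslope : 0 <= alpha * exp (/ alpha * c) - exp c).
{ pose proof (inv_lt_1 _ Hal) as Hb.
  pose proof (ln_le_pred (/ alpha) ltac:(lra)) as Hl.
  rewrite ln_Rinv in Hl by lra.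
  replace (exp c) with (exp (/ alpha * c) * exp ((1 - / alpha) * c))
    by (rewrite <- exp_plus; f_equal; ring).
  assert (exp ((1 - / alpha) * c) <= alpha).
  { rewrite <- (exp_ln alpha) at 2 by lra.
    assert ((1 - / alpha) * c <= ln alpha) by nra.
    destruct (Rle_lt_or_eq_dec _ _ H) as [H'|H'].
    - left. now apply exp_increasing.
    - rewrite H'. right. reflexivity. }
  pose proof (exp_pos (/ alpha * c)). nra. }
assert (0 <= psi L - psi 0) by (rewrite E; nra).
unfold psi in H. rewrite Rmult_0_r, exp_0 in H.
replace (/ alpha * L) with (L / alpha) in H by (unfold Rdiv; ring). lra.
Qed.

(* With [L = - ln m], the case [L > 1] follows from [alpha >= L (1/m - 1)]. *)
Lemma root_gap (alpha m : R) :
  1 < alpha -> 0 < m < 1 -> Rpower (1 - m) alpha <= m ->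
  / m - 1 <= alpha * alpha * (Rpower m (- / alpha) - 1).
Proof.
intros Hal Hm Hy. set (L := - ln m).
assert (HL : 0 < L).
{ unfold L. pose proof (ln_le_pred m ltac:(lra)). lra. }
assert (Em : / m = exp L)
  by (unfold L; rewrite exp_Ropp, exp_ln by lra; reflexivity).
assert (Ep : Rpower m (- / alpha) = exp (L / alpha))
  by (unfold Rpower, L; f_equal; unfold Rdiv; ring).
rewrite Ep. destruct (Rle_or_lt L 1) as [H1|H1].
- rewrite Em. apply expm1_scaled_ge; lra.
(* The hypothesis reads [L <= - alpha * ln (1 - m)], and [- ln (1 - m) <= m / (1 - m)]. *)
- assert (HyL : alpha * ln (1 - m) <= - L).
  { replace (alpha * ln (1 - m)) with (ln (Rpower (1 - m) alpha))
      by (unfold Rpower; now rewrite ln_exp).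
    replace (- L) with (ln m) by (unfold L; ring).
    destruct Hy as [Hy|Hy].
    - left. apply ln_increasing; [apply Rpower_pos | assumption].
    - rewrite Hy. right. reflexivity. }
  assert (Hinv : 0 < / (1 - m)) by (apply Rinv_0_lt_compat; lra).
  pose proof (ln_le_pred _ Hinv) as Hl. rewrite ln_Rinv in Hl by lra.
  replace (/ (1 - m) - 1) with (m / (1 - m)) in Hl by (field; lra).
  assert (HaL : L <= alpha * (m / (1 - m))) by nra.
  assert (HaL' : L * (/ m - 1) <= alpha).
  { replace (/ m - 1) with ((1 - m) / m) by (field; lra).
    apply (Rmult_le_compat_r ((1 - m) / m)) in HaL.
    - replace (alpha * (m / (1 - m)) * ((1 - m) / m)) with alpha in HaL
        by (field; lra). exact HaL.
    - apply Rlt_le, Rdiv_lt_0_compat; lra. }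
  assert (Hm1 : 0 < / m - 1).
  { replace (/ m - 1) with ((1 - m) / m) by (field; lra).
    apply Rdiv_lt_0_compat; lra. }
  pose proof (exp_ineq1_le (L / alpha)) as He.
  (* Since [L > 1], the bound [HaL'] gives [/ m - 1 <= alpha <= alpha * L]; then
     [exp (L / alpha) - 1 >= L / alpha]. *)
  apply Rle_trans with (alpha * L).
  + nra.
  + apply Rle_trans with (alpha * alpha * (L / alpha)).
    * right. field. lra.
    * apply Rmult_le_compat_l; [nra | lra].
Qed.

(** In terms of slopes, the chord slope [x4 / (x7 - x3)] is at most [alpha] times [|f'(x3)|]. This
    is [root_gap] for [m = (a - x4) / a = (x3 / x7)^alpha]; its hypothesis survives the division by
    [a^alpha] because [a > 1]. *)
Lemma root_gap_scaled (alpha a x3 x4 x7 : R) :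
  1 < alpha -> 1 < a -> 0 < x3 -> 0 < x4 -> 0 < x7 ->
  Rpower x7 alpha = a -> Rpower x3 alpha = a - x4 ->
  Rpower x4 alpha <= a - x4 ->
  x4 * x3 <= alpha * alpha * (a - x4) * (x7 - x3).
Proof.
intros Hal Ha H3 H4 H7 E7 E3 Hle.
pose proof (Rpower_pos x3 alpha) as Hd. rewrite E3 in Hd.
set (m := (a - x4) / a).
assert (Hm : 0 < m < 1).
{ unfold m. split; [apply Rdiv_lt_0_compat; lra | apply Rdiv_lt_1; lra]. }
assert (E1m : 1 - m = x4 / a) by (unfold m; field; lra).
assert (Hy : Rpower (1 - m) alpha <= m).
{ rewrite E1m. unfold Rdiv.
  rewrite <- Rpower_mult_distr by (assumption || apply Rinv_0_lt_compat; lra).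
  assert (Hia : 0 < / a) by (apply Rinv_0_lt_compat; lra).
  assert (Ht : Rpower (/ a) alpha <= / a).
  { rewrite <- (Rpower_1 (/ a)) at 2 by assumption. unfold Rpower.
    rewrite ln_Rinv by lra.
    assert (0 < ln a) by (rewrite <- ln_1; apply ln_increasing; lra).
    left. apply exp_increasing. nra. }
  unfold m, Rdiv. pose proof (Rpower_pos x4 alpha). pose proof (Rpower_pos (/ a) alpha).
  apply Rmult_le_compat; lra. }
pose proof (root_gap alpha m Hal Hm Hy) as H.
assert (Er : Rpower m (- / alpha) = x7 / x3).
{ rewrite <- (RpowerK_inv alpha x7), <- (RpowerK_inv alpha x3), E7, E3 by lra.
  rewrite Rpower_Ropp. unfold m, Rdiv.
  rewrite <- Rpower_mult_distr by (assumption || apply Rinv_0_lt_compat; lra).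
  assert (Ei : Rpower (/ a) (/ alpha) = / Rpower a (/ alpha)).
  { unfold Rpower. rewrite ln_Rinv, <- exp_Ropp by lra. f_equal. ring. }
  rewrite Ei.
  pose proof (Rpower_pos a (/ alpha)). pose proof (Rpower_pos (a - x4) (/ alpha)).
  field. lra. }
rewrite Er in H.
apply (Rmult_le_compat_r ((a - x4) * x3)) in H; [|nra].
replace ((/ m - 1) * ((a - x4) * x3)) with (x4 * x3) in H
  by (unfold m; field; lra).
replace (alpha * alpha * (x7 / x3 - 1) * ((a - x4) * x3))
  with (alpha * alpha * (a - x4) * (x7 - x3)) in H by (field; lra).
exact H.
Qed.

(* The inverse slopes multiply to [1 / |(f^4)'(a)|]. Each factor of [(f^4)'] is
   compared with a chord slope between the orbits of [a] and of [x5]: the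
   chords from [a] and [x2] go in the right direction by convexity, the one from
   [x3] loses at most the factor supplied by [root_gap_scaled]. *)
Lemma inv_multiplier_le_1 (alpha a x7 w x5 x4 x3 v : R) :
  1 < alpha -> 1 < a -> 0 < x7 -> 0 < w -> 0 < x5 -> 0 < x4 -> 0 < x3 -> 0 < v ->
  Rpower x7 alpha = a -> Rpower w alpha = a - x7 -> Rpower x5 alpha = a + w ->
  Rpower x4 alpha = a - x5 -> Rpower x3 alpha = a - x4 ->
  Rpower v alpha = a - x3 -> Rpower a alpha = a + v ->
  inv_slope alpha a * inv_slope alpha v * inv_slope alpha x3 * inv_slope alpha x4
    <= 1.
Proof.
intros Hal Ha H7 Hw H5 H4 H3 Hv E7 Ew E5 E4 E3 Ev Ea.
pose proof (Rpower_pos x3 alpha) as Hd3. rewrite E3 in Hd3.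
(* The order [x4 < x7 < x5] supplies the last hypothesis of [root_gap_scaled], as
   [x4^alpha = a - x5 <= a - x4]. *)
assert (L47 : x4 < x7).
{ apply Rpower_lt_cancel with alpha; lra. }
assert (L75 : x7 < x5).
{ apply Rpower_lt_cancel with alpha; lra. }
assert (L37 : x3 < x7).
{ apply Rpower_lt_cancel with alpha; lra. }
pose proof (root_gap_scaled alpha a x3 x4 x7 Hal Ha H3 H4 H7 E7 E3 ltac:(lra)) as G.
pose proof (Rpower_tangent_convex alpha x5 a Hal H5 ltac:(lra)) as T1.
pose proof (Rpower_tangent_convex alpha w v Hal Hw Hv) as T2.
rewrite !inv_slope_inv by lra.
pose proof (Rpower_pos a (alpha - 1)) as Pa.
pose proof (Rpower_pos v (alpha - 1)) as Pv.
assert (Q3 : Rpower x3 (alpha - 1) * x3 = a - x4)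
  by (rewrite Rpower_pred, E3 by assumption; field; lra).
assert (Q4 : Rpower x4 (alpha - 1) * x4 = a - x5)
  by (rewrite Rpower_pred, E4 by assumption; field; lra).
pose proof (Rpower_pos x3 (alpha - 1)) as P3.
pose proof (Rpower_pos x4 (alpha - 1)) as P4.
set (A := Rpower a (alpha - 1)) in *. set (V := Rpower v (alpha - 1)) in *.
set (X3 := Rpower x3 (alpha - 1)) in *. set (X4 := Rpower x4 (alpha - 1)) in *.
clearbody A V X3 X4.
rewrite <- !Rinv_mult. rewrite <- Rinv_1. apply Rinv_le_contravar; [lra|].
assert (C1 : v - w <= alpha * A * (a - x5)) by nra.
assert (C2 : x7 - x3 <= alpha * V * (v - w)) by nra.
assert (C3 : x4 <= alpha * alpha * X3 * (x7 - x3)).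
{ apply Rmult_le_reg_r with x3; [assumption|].
  replace (alpha * alpha * X3 * (x7 - x3) * x3)
    with (alpha * alpha * (X3 * x3) * (x7 - x3)) by ring.
  rewrite Q3. exact G. }
assert (C12 : x7 - x3 <= alpha * V * (alpha * A * (a - x5))).
{ eapply Rle_trans; [exact C2|]. apply Rmult_le_compat_l; [nra | exact C1]. }
assert (C : x4 <= alpha * alpha * X3 * (alpha * V * (alpha * A * (a - x5)))).
{ eapply Rle_trans; [exact C3|]. apply Rmult_le_compat_l; [|exact C12].
  apply Rlt_le. repeat apply Rmult_lt_0_compat; lra. }
(* The factor [alpha] lost at [x3] is regained at [x4]: there [|f'(x4)|] equals
   [alpha * (a - x5) / x4], that is [alpha] times the chord slope from the critical point. *)
apply Rmult_le_reg_r with x4; [assumption|].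
replace (alpha * A * (alpha * V) * (alpha * X3) * (alpha * X4) * x4)
  with (alpha * alpha * X3 * (alpha * V * (alpha * A * (X4 * x4)))) by ring.
rewrite Q4. lra.
Qed.

(* [w = |x6|], [v = |x2|]; the hypothesis on [Rpower a alpha] is [x1 = a]. *)
Lemma return8_slope_lt_1 (alpha a x7 w x5 x4 x3 v : R) :
  1 < alpha -> 1 < a -> 0 < x7 -> 0 < w -> 0 < x5 -> 0 < x4 -> 0 < x3 -> 0 < v ->
  Rpower x7 alpha = a -> Rpower w alpha = a - x7 -> Rpower x5 alpha = a + w ->
  Rpower x4 alpha = a - x5 -> Rpower x3 alpha = a - x4 ->
  Rpower v alpha = a - x3 -> Rpower a alpha = a + v ->
  inv_slope alpha a * (1 + inv_slope alpha v * (1 - inv_slope alpha x3 *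
    (1 - inv_slope alpha x4 * (1 - inv_slope alpha x5 *
      (1 + inv_slope alpha w * (1 - inv_slope alpha x7)))))) < 1.
Proof.
intros Hal Ha H7 Hw H5 H4 H3 Hv E7 Ew E5 E4 E3 Ev Ea.
pose proof (Rpower_pos x4 alpha) as Hd4. rewrite E4 in Hd4.
pose proof (Rpower_pos w alpha) as Hdw. rewrite Ew in Hdw.
assert (L37 : x3 < x7) by (apply Rpower_lt_cancel with alpha; lra).
assert (Lwv : w < v) by (apply Rpower_lt_cancel with alpha; lra).
pose proof (return4_slope_lt_1 alpha a x7 w x5 Hal ltac:(lra) H7 Hw H5 E7 Ew E5
  ltac:(lra)) as HB.
pose proof (inv_multiplier_le_1 alpha a x7 w x5 x4 x3 v Hal Ha H7 Hw H5 H4 H3 Hv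
  E7 Ew E5 E4 E3 Ev Ea) as HM.
pose proof (inv_slope_decr alpha x5 a Hal ltac:(lra)) as K15.
pose proof (inv_slope_decr alpha w v Hal ltac:(lra)) as K26.
pose proof (inv_slope_decr alpha x3 x7 Hal ltac:(lra)) as K37.
assert (K7 : inv_slope alpha x7 < 1).
{ rewrite inv_slopeE, E7 by lra. apply Rdiv_lt_1; nra. }
pose proof (inv_slope_pos alpha a ltac:(lra)) as P1.
pose proof (inv_slope_pos alpha v ltac:(lra)) as P2.
pose proof (inv_slope_pos alpha x3 ltac:(lra)) as P3.
pose proof (inv_slope_pos alpha x4 ltac:(lra)) as P4.
pose proof (inv_slope_pos alpha x5 ltac:(lra)) as P5.
pose proof (inv_slope_pos alpha w ltac:(lra)) as P6.
set (k1 := inv_slope alpha a) in *. set (k2 := inv_slope alpha v) in *.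
set (k3 := inv_slope alpha x3) in *. set (k4 := inv_slope alpha x4) in *.
set (k5 := inv_slope alpha x5) in *. set (k6 := inv_slope alpha w) in *.
set (k7 := inv_slope alpha x7) in *.
clearbody k1 k2 k3 k4 k5 k6 k7. clear - HB HM K15 K26 K37 K7 P1 P2 P3 P4 P5 P6.
set (B := 1 - k5 * (1 + k6 * (1 - k7))).
(* Comparison of the orbits of [x1] and [x5]: [k1 < k5], [k2 < k6] and [k7 < k3]. Positivity of
   [1 - k7] lets the bound on [k1 * k2] be multiplied by it. *)
assert (H12 : k1 * k2 < k5 * k6) by (apply Rmult_le_0_lt_compat; lra).
assert (HAB : B < 1 - k1 - k1 * k2 * (1 - k3)).
{ assert (k1 * k2 * (1 - k3) <= k5 * k6 * (1 - k7)).
  { apply Rle_trans with (k1 * k2 * (1 - k7)).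
    - apply Rmult_le_compat_l; [nra | lra].
    - apply Rmult_le_compat_r; lra. }
  unfold B. nra. }
assert (HB0 : 0 < B) by (unfold B; lra).
assert (k1 * k2 * k3 * k4 * B <= 1 * B) by (apply Rmult_le_compat_r; lra).
replace (k1 * (1 + k2 * (1 - k3 * (1 - k4 * B))))
  with (k1 + k1 * k2 * (1 - k3) + k1 * k2 * k3 * k4 * B) by ring.
lra.
Qed.

(** * First crossings *)

Lemma continuity_pt_sign (h : R -> R) (x : R) :
  continuity_pt h x -> 0 < h x ->
  exists d, 0 < d /\ forall y, Rabs (y - x) < d -> 0 < h y.
Proof.
intros Hc Hx. destruct (Hc (h x) Hx) as [d [Hd H]].
exists d. split; [exact Hd|]. intros y Hy.
destruct (Req_EM_T x y) as [<-|Hne]; [assumption|].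
assert (Hdist : Rabs (h y - h x) < h x).
{ apply H. split; [split; [exact I | exact Hne] | exact Hy]. }
apply Rabs_def2 in Hdist. lra.
Qed.

(** The crossing is the supremum of the points up to which [h] stays negative. If [h] were negative
    there, continuity would extend the set; if positive, [h] would be positive slightly earlier. *)
Lemma first_crossing (h : R -> R) (x y : R) :
  x <= y -> (forall z, x <= z <= y -> continuity_pt h z) ->
  h x < 0 -> 0 <= h y ->
  exists z, x < z <= y /\ h z = 0 /\ forall s, x <= s < z -> h s < 0.
Proof.
intros Hxy Hc Hx Hy.
set (E := fun s => x <= s <= y /\ forall r, x <= r <= s -> h r < 0).
assert (HEx : E x).
{ split; [lra|]. intros r Hr. replace r with x by lra. exact Hx. }
destruct (completeness E) as [m [Hub Hlub]].
- exists y. intros s [Hs _]. lra.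
- exists x. exact HEx.
- assert (Hm : x <= m <= y).
  { split; [now apply Hub|]. apply Hlub. intros s [Hs _]. lra. }
  assert (Hleft : forall s, x <= s < m -> h s < 0).
  { intros s Hs. destruct (Rlt_or_le (h s) 0) as [|Hge]; [assumption|exfalso].
    assert (m <= s); [|lra]. apply Hlub. intros e [He1 He2].
    destruct (Rle_or_lt e s) as [|Hse]; [assumption|].
    specialize (He2 s ltac:(lra)). lra. }
  exists m. destruct (Rtotal_order (h m) 0) as [Hneg|[Hz|Hpos]].
  + exfalso.
    destruct (continuity_pt_sign (- h)%F m) as [d [Hd Hs]].
    { apply continuity_pt_opp, Hc, Hm. }
    { unfold opp_fct. lra. }
    destruct (Rle_lt_or_eq_dec m y ltac:(lra)) as [Hmy|Hmy];
      [|rewrite Hmy in Hneg; lra].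
    assert (HE : E (Rmin y (m + d / 2))).
    { assert (x <= Rmin y (m + d / 2)) by (apply Rmin_glb; lra).
      pose proof (Rmin_l y (m + d / 2)). pose proof (Rmin_r y (m + d / 2)).
      split; [lra|]. intros r Hr.
      destruct (Rlt_or_le r m) as [Hrm|Hrm]; [apply Hleft; lra|].
      specialize (Hs r ltac:(apply Rabs_def1; lra)). unfold opp_fct in Hs. lra. }
    apply Hub in HE. assert (m < Rmin y (m + d / 2)) by (apply Rmin_glb_lt; lra). lra.
  + split; [|now split]. split; [|lra].
    destruct (Rle_lt_or_eq_dec x m ltac:(lra)) as [|<-]; lra.
  + exfalso.
    destruct (continuity_pt_sign h m (Hc m Hm) Hpos) as [d [Hd Hs]].
    destruct (Rle_lt_or_eq_dec x m ltac:(lra)) as [Hxm|<-]; [|lra].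
    assert (Rmax x (m - d / 2) < m) by (apply Rmax_lub_lt; lra).
    pose proof (Rmax_l x (m - d / 2)). pose proof (Rmax_r x (m - d / 2)).
    specialize (Hleft (Rmax x (m - d / 2)) ltac:(lra)).
    specialize (Hs (Rmax x (m - d / 2)) ltac:(apply Rabs_def1; lra)). lra.
Qed.

Lemma derivable_pt_lim_neg (h : R -> R) (x l : R) :
  derivable_pt_lim h x l -> l < 0 ->
  exists d, 0 < d /\
    (forall s, 0 < s < d -> h (x + s) < h x) /\
    (forall s, 0 < s < d -> h x < h (x - s)).
Proof.
intros Hh Hl. destruct (Hh (- l) ltac:(lra)) as [d Hd].
exists d. split; [apply cond_pos|]. split; intros s Hs.
- specialize (Hd s ltac:(lra) ltac:(apply Rabs_def1; lra)).
  apply Rabs_def2 in Hd.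
  assert (H : (h (x + s) - h x) / s * s < 0 * s) by (apply Rmult_lt_compat_r; lra).
  replace ((h (x + s) - h x) / s * s) with (h (x + s) - h x) in H by (field; lra).
  lra.
- specialize (Hd (- s) ltac:(lra) ltac:(apply Rabs_def1; lra)).
  apply Rabs_def2 in Hd.
  assert (H : (h (x + - s) - h x) / - s * s < 0 * s) by (apply Rmult_lt_compat_r; lra).
  replace ((h (x + - s) - h x) / - s * s) with (h x - h (x + - s)) in H by (field; lra).
  unfold Rminus. lra.
Qed.

Lemma derivable_pt_lim_continuity (h : R -> R) (x l : R) :
  derivable_pt_lim h x l -> continuity_pt h x.
Proof.
intros H. apply derivable_continuous_pt. now exists l.
Qed.

(** Just after a zero [h] is negative. The next zero would then be reached from below, whereas the
    derivative there forces [h] to be positive just before it. *)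
Lemma neg_after_zero (h h' : R -> R) (x y : R) :
  x < y -> (forall z, x <= z <= y -> derivable_pt_lim h z (h' z)) ->
  (forall z, x <= z <= y -> h z = 0 -> h' z < 0) ->
  h x = 0 -> h y < 0.
Proof.
intros Hxy Hd Hz Hx. destruct (Rlt_or_le (h y) 0) as [|Hy]; [assumption|exfalso].
destruct (derivable_pt_lim_neg h x (h' x) (Hd x ltac:(lra)) (Hz x ltac:(lra) Hx))
  as [d [Hd0 [Hright _]]].
set (s := Rmin (d / 2) (y - x)).
assert (Hs : 0 < s) by (apply Rmin_glb_lt; lra).
pose proof (Rmin_l (d / 2) (y - x)) as Hs1. pose proof (Rmin_r (d / 2) (y - x)) as Hs2.
fold s in Hs1, Hs2. specialize (Hright s ltac:(lra)).
destruct (first_crossing h (x + s) y) as [z [Hzr [Ez Hbefore]]]; try lra.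
{ intros z Hzr. apply derivable_pt_lim_continuity with (h' z), Hd. lra. }
destruct (derivable_pt_lim_neg h z (h' z) (Hd z ltac:(lra)) (Hz z ltac:(lra) Ez))
  as [e [He [_ Hleft]]].
(* At [z - r] the function is positive by the slope at [z], and negative because [z - r] still lies
   between [x + s] and the first crossing. *)
set (r := Rmin (e / 2) (z - (x + s))).
assert (Hr : 0 < r) by (apply Rmin_glb_lt; lra).
pose proof (Rmin_l (e / 2) (z - (x + s))) as Hr1.
pose proof (Rmin_r (e / 2) (z - (x + s))) as Hr2.
fold r in Hr1, Hr2. specialize (Hleft r ltac:(lra)).
specialize (Hbefore (z - r) ltac:(lra)). lra.
Qed.

(** Up to a first return to zero [h] has negative slope, so by the mean value theorem it cannot
    climb back. *)
Lemma neg_stays_neg (h h' : R -> R) (x y : R) :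
  x <= y -> (forall z, x <= z <= y -> derivable_pt_lim h z (h' z)) ->
  (forall z, x <= z <= y -> h z < 0 -> h' z < 0) ->
  h x < 0 -> h y < 0.
Proof.
intros Hxy Hd Hz Hx. destruct (Rlt_or_le (h y) 0) as [|Hy]; [assumption|exfalso].
destruct (first_crossing h x y) as [z [Hzr [Ez Hbefore]]]; try lra.
{ intros z Hzr. apply derivable_pt_lim_continuity with (h' z), Hd. lra. }
destruct (MVT_cor2 h h' x z ltac:(lra)) as [c [E Hc]].
{ intros c Hc. apply Hd. lra. }
pose proof (Hz c ltac:(lra) (Hbefore c ltac:(lra))). nra.
Qed.

(** * Comparison estimates for powers and roots *)

Lemma lt_scaled_root (b c eta : R) :
  0 < b < 1 -> 0 < c -> 0 < eta ->
  exists e, 0 < e < eta /\ e < c * Rpower e b.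
Proof.
intros Hb Hc Heta.
(* Any small [e] with [Rpower e (1 - b) < c] works; the halves make both inequalities strict. *)
set (e := Rmin (eta / 2) (Rpower (c / 2) (/ (1 - b)))).
assert (He : 0 < e) by (apply Rmin_glb_lt; [lra | apply Rpower_pos]).
pose proof (Rmin_l (eta / 2) (Rpower (c / 2) (/ (1 - b)))) as H1. fold e in H1.
pose proof (Rmin_r (eta / 2) (Rpower (c / 2) (/ (1 - b)))) as H2. fold e in H2.
exists e. split; [lra|].
assert (H3 : Rpower e (1 - b) <= c / 2).
{ rewrite <- (Rpower_invK (1 - b) (c / 2)) by lra.
  apply Rle_Rpower_l; lra. }
replace (Rpower e b) with (e / Rpower e (1 - b)).
2:{ unfold Rminus. rewrite Rpower_plus, Rpower_Ropp, Rpower_1 by assumption.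
    pose proof (Rpower_pos e b). field. lra. }
pose proof (Rpower_pos e (1 - b)) as P.
apply Rmult_lt_reg_r with (Rpower e (1 - b)); [assumption|].
replace (c * (e / Rpower e (1 - b)) * Rpower e (1 - b)) with (c * e) by (field; lra).
nra.
Qed.

Lemma lt_Rpower (alpha a : R) : 1 < alpha -> 1 < a -> a < Rpower a alpha.
Proof.
intros Hal Ha. rewrite <- (Rpower_1 a) at 1 by lra. now apply Rpower_lt.
Qed.

(** The tangent inequality at [y] divided by its slope; it holds on either side of [y]. *)
Lemma chord_ge_inv_slope (alpha x y : R) :
  1 < alpha -> 0 < x -> 0 < y ->
  inv_slope alpha y * (Rpower y alpha - Rpower x alpha) <= y - x.
Proof.
intros Hal Hx Hy. pose proof (Rpower_tangent_convex alpha x y Hal Hx Hy) as T.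
pose proof (Rpower_pos y (alpha - 1)) as P.
rewrite inv_slope_inv by lra.
set (D := alpha * Rpower y (alpha - 1)) in *.
assert (0 < D) by (apply Rmult_lt_0_compat; lra).
apply Rmult_le_reg_l with D; [assumption|].
replace (D * (/ D * (Rpower y alpha - Rpower x alpha)))
  with (Rpower y alpha - Rpower x alpha) by (field; lra).
lra.
Qed.

(** * The pulled-back orbit *)

(* [|x_j|] as obtained by pulling back [x_8 = 0] along the kneading sequence;
   [x_6] and [x_2] are the negative points. Outside the domain where the
   arguments of the roots are positive the values are junk. *)
Definition orb7 (alpha a : R) : R := Rpower a (/ alpha).
Definition orb6 (alpha a : R) : R := Rpower (a - orb7 alpha a) (/ alpha).
Definition orb5 (alpha a : R) : R := Rpower (a + orb6 alpha a) (/ alpha).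
Definition orb4 (alpha a : R) : R := Rpower (a - orb5 alpha a) (/ alpha).
Definition orb3 (alpha a : R) : R := Rpower (a - orb4 alpha a) (/ alpha).
Definition orb2 (alpha a : R) : R := Rpower (a - orb3 alpha a) (/ alpha).
Definition orb1 (alpha a : R) : R := Rpower (a + orb2 alpha a) (/ alpha).

Lemma root_lt (alpha a y : R) :
  1 < alpha -> 1 < a -> 0 < y < a -> Rpower (a - y) (/ alpha) < a.
Proof.
intros Hal Ha Hy. pose proof (lt_Rpower alpha a Hal Ha).
apply Rpower_lt_cancel with alpha; try lra; [apply Rpower_pos|].
rewrite Rpower_invK; lra.
Qed.

Lemma orb7_lt (alpha a : R) : 1 < alpha -> 1 < a -> orb7 alpha a < a.
Proof.
intros Hal Ha. pose proof (lt_Rpower alpha a Hal Ha).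
apply Rpower_lt_cancel with alpha; try lra; [apply Rpower_pos|].
unfold orb7. rewrite Rpower_invK; lra.
Qed.

Lemma orb6_lt (alpha a : R) : 1 < alpha -> 1 < a -> orb6 alpha a < a.
Proof.
intros Hal Ha. pose proof (orb7_lt alpha a Hal Ha).
apply root_lt; try assumption. split; [apply Rpower_pos | assumption].
Qed.

Lemma orb4_lt (alpha a : R) :
  1 < alpha -> 1 < a -> orb5 alpha a < a -> orb4 alpha a < a.
Proof.
intros Hal Ha H5. apply root_lt; try assumption. split; [apply Rpower_pos | assumption].
Qed.

Lemma orb3_lt (alpha a : R) :
  1 < alpha -> 1 < a -> orb5 alpha a < a -> orb3 alpha a < a.
Proof.
intros Hal Ha H5. pose proof (orb4_lt alpha a Hal Ha H5).
apply root_lt; try assumption. split; [apply Rpower_pos | assumption].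
Qed.

Lemma orb2_lt (alpha a : R) :
  1 < alpha -> 1 < a -> orb5 alpha a < a -> orb2 alpha a < a.
Proof.
intros Hal Ha H5. pose proof (orb3_lt alpha a Hal Ha H5).
apply root_lt; try assumption. split; [apply Rpower_pos | assumption].
Qed.

Lemma orb765_pow (alpha a : R) :
  1 < alpha -> 1 < a ->
  Rpower (orb7 alpha a) alpha = a /\
  Rpower (orb6 alpha a) alpha = a - orb7 alpha a /\
  Rpower (orb5 alpha a) alpha = a + orb6 alpha a.
Proof.
intros Hal Ha. pose proof (orb7_lt alpha a Hal Ha).
pose proof (Rpower_pos (a - orb7 alpha a) (/ alpha)) as P6.
fold (orb6 alpha a) in P6.
repeat split; apply Rpower_invK; lra.
Qed.

Lemma orb4321_pow (alpha a : R) :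
  1 < alpha -> 1 < a -> orb5 alpha a < a ->
  Rpower (orb4 alpha a) alpha = a - orb5 alpha a /\
  Rpower (orb3 alpha a) alpha = a - orb4 alpha a /\
  Rpower (orb2 alpha a) alpha = a - orb3 alpha a /\
  Rpower (orb1 alpha a) alpha = a + orb2 alpha a.
Proof.
intros Hal Ha H5. pose proof (orb4_lt alpha a Hal Ha H5).
pose proof (orb3_lt alpha a Hal Ha H5).
pose proof (Rpower_pos (a - orb3 alpha a) (/ alpha)) as P2.
fold (orb2 alpha a) in P2.
repeat split; apply Rpower_invK; lra.
Qed.

(** * Derivatives of the pulled-back points in the parameter *)

Definition orb5' (alpha a : R) : R :=
  inv_slope alpha (orb5 alpha a) *
    (1 + inv_slope alpha (orb6 alpha a) * (1 - inv_slope alpha (orb7 alpha a))).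

Definition orb1' (alpha a : R) : R :=
  inv_slope alpha (orb1 alpha a) * (1 + inv_slope alpha (orb2 alpha a) *
    (1 - inv_slope alpha (orb3 alpha a) *
      (1 - inv_slope alpha (orb4 alpha a) * (1 - orb5' alpha a)))).

Lemma derivable_pt_lim_root (alpha : R) (g : R -> R) (x l : R) :
  0 < alpha -> 0 < g x -> derivable_pt_lim g x l ->
  derivable_pt_lim (fun z => Rpower (g z) (/ alpha)) x
    (inv_slope alpha (Rpower (g x) (/ alpha)) * l).
Proof.
intros Hal Hg Hd.
(* An inverse branch has as slope the inverse slope of [f] at the root: the exponent
   [(1 - alpha) / alpha] is [/ alpha - 1]. *)
replace (inv_slope alpha (Rpower (g x) (/ alpha)))
  with (/ alpha * Rpower (g x) (/ alpha - 1)).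
2:{ unfold inv_slope. rewrite Rpower_mult. do 2 f_equal. field. lra. }
apply (derivable_pt_lim_comp g (fun y => Rpower y (/ alpha))); [assumption|].
now apply derivable_pt_lim_power.
Qed.

Lemma derivable_pt_lim_id_minus (g : R -> R) (x l : R) :
  derivable_pt_lim g x l -> derivable_pt_lim (fun z => z - g z) x (1 - l).
Proof.
intros H. apply (derivable_pt_lim_minus (fun z => z) g); [|assumption].
apply derivable_pt_lim_id.
Qed.

Lemma derivable_pt_lim_id_plus (g : R -> R) (x l : R) :
  derivable_pt_lim g x l -> derivable_pt_lim (fun z => z + g z) x (1 + l).
Proof.
intros H. apply (derivable_pt_lim_plus (fun z => z) g); [|assumption].
apply derivable_pt_lim_id.
Qed.

Lemma derivable_pt_lim_orb5 (alpha a : R) :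
  1 < alpha -> 1 < a -> derivable_pt_lim (orb5 alpha) a (orb5' alpha a).
Proof.
intros Hal Ha. pose proof (orb7_lt alpha a Hal Ha).
pose proof (Rpower_pos (a - orb7 alpha a) (/ alpha)) as P6.
fold (orb6 alpha a) in P6.
apply (derivable_pt_lim_root alpha (fun z => z + orb6 alpha z)); [lra | lra |].
apply derivable_pt_lim_id_plus.
apply (derivable_pt_lim_root alpha (fun z => z - orb7 alpha z)); [lra | lra |].
apply derivable_pt_lim_id_minus.
rewrite <- (Rmult_1_r (inv_slope alpha _)).
apply (derivable_pt_lim_root alpha (fun z => z)); [lra | lra |].
apply derivable_pt_lim_id.
Qed.

Lemma derivable_pt_lim_orb1 (alpha a : R) :
  1 < alpha -> 1 < a -> orb5 alpha a < a ->
  derivable_pt_lim (orb1 alpha) a (orb1' alpha a).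
Proof.
intros Hal Ha H5. pose proof (orb4_lt alpha a Hal Ha H5).
pose proof (orb3_lt alpha a Hal Ha H5).
pose proof (Rpower_pos (a - orb3 alpha a) (/ alpha)) as P2.
fold (orb2 alpha a) in P2.
apply (derivable_pt_lim_root alpha (fun z => z + orb2 alpha z)); [lra | lra |].
apply derivable_pt_lim_id_plus.
apply (derivable_pt_lim_root alpha (fun z => z - orb3 alpha z)); [lra | lra |].
apply derivable_pt_lim_id_minus.
apply (derivable_pt_lim_root alpha (fun z => z - orb4 alpha z)); [lra | lra |].
apply derivable_pt_lim_id_minus.
apply (derivable_pt_lim_root alpha (fun z => z - orb5 alpha z)); [lra | lra |].
apply derivable_pt_lim_id_minus.
now apply derivable_pt_lim_orb5.
Qed.

Lemma orb5'_lt_1 (alpha a : R) :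
  1 < alpha -> 1 < a -> orb5 alpha a < a -> orb5' alpha a < 1.
Proof.
intros Hal Ha H5. destruct (orb765_pow alpha a Hal Ha) as [E7 [E6 E5]].
apply return4_slope_lt_1 with a; try assumption; try apply Rpower_pos. lra.
Qed.

Lemma orb1'_lt_1 (alpha a : R) :
  1 < alpha -> 1 < a -> orb5 alpha a < a -> orb1 alpha a = a -> orb1' alpha a < 1.
Proof.
intros Hal Ha H5 H1. destruct (orb765_pow alpha a Hal Ha) as [E7 [E6 E5]].
destruct (orb4321_pow alpha a Hal Ha H5) as [E4 [E3 [E2 E1]]].
unfold orb1', orb5'. rewrite H1 in *.
apply return8_slope_lt_1; try assumption; apply Rpower_pos.
Qed.

(** * Uniqueness of the fixed point *)

Lemma orb5_lt_upward (alpha a b : R) :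
  1 < alpha -> 1 < a <= b -> orb5 alpha a < a -> orb5 alpha b < b.
Proof.
intros Hal Hab H5.
assert (H : orb5 alpha b - b < 0); [|lra].
(* Wherever [orb5 alpha z < z], the bound [orb5' < 1] applies, so the gap only widens. *)
apply (neg_stays_neg (fun z => orb5 alpha z - z) (fun z => orb5' alpha z - 1) a b);
  try lra.
- intros z Hz. apply (derivable_pt_lim_minus (orb5 alpha) (fun z => z)).
  + apply derivable_pt_lim_orb5; lra.
  + apply derivable_pt_lim_id.
- intros z Hz Hneg. pose proof (orb5'_lt_1 alpha z Hal ltac:(lra) ltac:(lra)). lra.
Qed.

(** The domain contains all of [[a, b]], and on it [orb1 alpha z - z] can cross zero only
    downwards. *)
Lemma orb1_lt_after_fixed (alpha a b : R) :
  1 < alpha -> 1 < a < b -> orb5 alpha a < a ->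
  orb1 alpha a = a -> orb1 alpha b < b.
Proof.
intros Hal Hab H5 H1.
assert (Hdom : forall z, a <= z <= b -> orb5 alpha z < z).
{ intros z Hz. apply orb5_lt_upward with a; lra. }
assert (H : orb1 alpha b - b < 0); [|lra].
apply (neg_after_zero (fun z => orb1 alpha z - z) (fun z => orb1' alpha z - 1) a b);
  try lra.
- intros z Hz. apply (derivable_pt_lim_minus (orb1 alpha) (fun z => z)).
  + apply derivable_pt_lim_orb1; [lra | lra | now apply Hdom].
  + apply derivable_pt_lim_id.
- intros z Hz H0.
  pose proof (orb1'_lt_1 alpha z Hal ltac:(lra) (Hdom z Hz) ltac:(lra)). lra.
Qed.

(** * Existence of the fixed point *)

Lemma large_parameter (alpha : R) :
  1 < alpha -> exists a, 1 < a /\ orb5 alpha a < a /\ orb1 alpha a < a.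
Proof.
(* At this parameter [a^alpha = 2 * a], so [f] sends [a] to the fixed point [- a] (for [alpha = 2]
   it is the Chebyshev parameter 2). Any root of [a + y] with [y < a] is then below [a]. *)
intros Hal. set (a := Rpower 2 (/ (alpha - 1))).
assert (Hi : 0 < / (alpha - 1)) by (apply Rinv_0_lt_compat; lra).
assert (Ha : 1 < a).
{ unfold a. rewrite <- (Rpower_O 2) at 1 by lra. apply Rpower_lt; lra. }
assert (E : Rpower a alpha = 2 * a).
{ assert (E : Rpower a (alpha - 1) = 2).
  { apply Rpower_invK; lra. }
  rewrite Rpower_pred in E by lra.
  rewrite <- E. field. lra. }
assert (Hroot : forall y, 0 < y < a -> Rpower (a + y) (/ alpha) < a).
{ intros y Hy. apply Rpower_lt_cancel with alpha; try lra; [apply Rpower_pos|].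
  rewrite Rpower_invK; lra. }
assert (H5 : orb5 alpha a < a).
{ apply Hroot. split; [apply Rpower_pos | now apply orb6_lt]. }
exists a. split; [assumption|]. split; [assumption|].
apply Hroot. split; [apply Rpower_pos | now apply orb2_lt].
Qed.

(** At [a = 1 + z] the difference [a - orb7] is at least of order [z], so [orb6] is at least of
    order [z^(1/alpha)]. For small [z] this exceeds the linear growth of [a^alpha]. *)
Lemma orb5_gt_near_1 (alpha a0 : R) :
  1 < alpha -> 1 < a0 -> exists a, 1 < a < a0 /\ a < orb5 alpha a.
Proof.
intros Hal Ha0. pose proof (inv_lt_1 alpha Hal) as Hb.
(* The constant is chosen so that [2 * alpha * z < ((1 - / alpha) * z)^(1/alpha)]; the caps ensure
   [alpha * z <= / 2] and [1 + z < a0]. *)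
destruct (lt_scaled_root (/ alpha) (Rpower (1 - / alpha) (/ alpha) / (2 * alpha))
  (Rmin (/ (2 * alpha)) (a0 - 1))) as [z [Hz Hlt]]; [assumption | |  |].
{ apply Rdiv_lt_0_compat; [apply Rpower_pos | lra]. }
{ apply Rmin_glb_lt; [apply Rinv_0_lt_compat|]; lra. }
pose proof (Rmin_l (/ (2 * alpha)) (a0 - 1)).
pose proof (Rmin_r (/ (2 * alpha)) (a0 - 1)).
assert (Hz2 : alpha * z <= / 2).
{ apply Rle_trans with (alpha * / (2 * alpha)); [apply Rmult_le_compat_l; lra|].
  right. field. lra. }
exists (1 + z). split; [lra|].
assert (Hw : 2 * alpha * z < orb6 alpha (1 + z)).
{ apply (Rmult_lt_compat_l (2 * alpha)) in Hlt; [|lra].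
  replace (2 * alpha * (Rpower (1 - / alpha) (/ alpha) / (2 * alpha) * Rpower z (/ alpha)))
    with (Rpower ((1 - / alpha) * z) (/ alpha)) in Hlt.
  2:{ rewrite <- Rpower_mult_distr by lra. field. lra. }
  apply Rlt_le_trans with (1 := Hlt). apply Rle_Rpower_l; [lra|].
  split; [apply Rmult_lt_0_compat; lra|].
  pose proof (Rpower_bernoulli_concave (/ alpha) (1 + z) Hb ltac:(lra)) as B.
  unfold orb7. lra. }
(* An upper bound from convexity: the tangent at [1 + z], evaluated at 1, gives
   [p * (1 - alpha * z) <= 1], and [alpha * z <= / 2]. *)
assert (Hp : Rpower (1 + z) alpha <= 1 + 2 * alpha * z).
{ pose proof (Rpower_tangent_convex alpha 1 (1 + z) Hal ltac:(lra) ltac:(lra)) as T.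
  rewrite Rpower_pred in T by lra.
  rewrite Rpower_1_base in T.
  pose proof (Rpower_pos (1 + z) alpha) as P.
  set (p := Rpower (1 + z) alpha) in *.
  replace (p + alpha * (p / (1 + z)) * (1 - (1 + z)))
    with (p * (1 - alpha * z / (1 + z))) in T by (field; lra).
  assert (Hq : alpha * z / (1 + z) <= alpha * z).
  { apply Rmult_le_reg_r with (1 + z); [lra|].
    replace (alpha * z / (1 + z) * (1 + z)) with (alpha * z) by (field; lra).
    assert (0 < alpha * z) by (apply Rmult_lt_0_compat; lra). nra. }
  assert (Hp1 : p * (1 - alpha * z) <= 1).
  { apply Rle_trans with (2 := T). apply Rmult_le_compat_l; lra. }
  assert (0 < alpha * z) by (apply Rmult_lt_0_compat; lra).
  assert (1 <= (1 + 2 * (alpha * z)) * (1 - alpha * z)) by nra.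
  apply Rmult_le_reg_r with (1 - alpha * z); lra. }
apply Rpower_lt_cancel with alpha; [lra | lra | apply Rpower_pos|].
destruct (orb765_pow alpha (1 + z) Hal ltac:(lra)) as [_ [_ E5]]. rewrite E5. lra.
Qed.

(* The infinite slope of [x4 = (a - x5)^(1/alpha)] at [x5 = a] pushes [x1] above
   [a] just inside the boundary of the domain [x5 < a]. *)
Lemma orb1_gt_near_boundary (alpha a a0 e : R) :
  1 < alpha -> 1 < a <= a0 -> 0 < e -> orb5 alpha a = a - e ->
  e < inv_slope alpha a0 * inv_slope alpha a0 * inv_slope alpha a0 * Rpower e (/ alpha) ->
  a < orb1 alpha a.
Proof.
intros Hal Ha He H5 Hlt.
assert (H5' : orb5 alpha a < a) by lra.
destruct (orb765_pow alpha a Hal ltac:(lra)) as [E7 [E6 E5]].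
destruct (orb4321_pow alpha a Hal (proj1 Ha) H5') as [E4 [E3 [E2 E1]]].
assert (Ex4 : Rpower e (/ alpha) = orb4 alpha a)
  by (unfold orb4; rewrite H5; f_equal; ring).
rewrite Ex4 in Hlt.
pose proof (orb7_lt alpha a Hal ltac:(lra)) as L7.
pose proof (orb2_lt alpha a Hal ltac:(lra) H5') as L2.
assert (P7 : 0 < orb7 alpha a) by apply Rpower_pos.
assert (P6 : 0 < orb6 alpha a) by apply Rpower_pos.
assert (P5 : 0 < orb5 alpha a) by apply Rpower_pos.
assert (P4 : 0 < orb4 alpha a) by apply Rpower_pos.
assert (P3 : 0 < orb3 alpha a) by apply Rpower_pos.
assert (P2 : 0 < orb2 alpha a) by apply Rpower_pos.
(* If [x5] were equal to [a], then [x4 = 0] and [x3], [x2], [x1] would coincide with [x7], [x6],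
   [x5]. The chords measure how far a positive [x4] separates them. *)
pose proof (chord_ge_inv_slope alpha (orb3 alpha a) (orb7 alpha a) Hal P3 P7) as C7.
rewrite E7, E3 in C7.
pose proof (chord_ge_inv_slope alpha (orb6 alpha a) (orb2 alpha a) Hal P6 P2) as C2.
rewrite E2, E6 in C2.
pose proof (chord_ge_inv_slope alpha (orb5 alpha a) a Hal P5 ltac:(lra)) as Ca.
rewrite E5, H5 in Ca.
apply Rpower_lt_cancel with alpha; [lra | lra | apply Rpower_pos|].
rewrite E1.
(* All points involved are at most [a <= a0], so [inv_slope alpha a0] bounds every inverse slope
   below; this uniform bound allows [e] to be fixed before [a]. *)
assert (Ka : inv_slope alpha a0 <= inv_slope alpha a).
{ destruct (proj2 Ha) as [H|<-]; [|lra]. left. apply inv_slope_decr; lra. }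
pose proof (inv_slope_decr alpha (orb7 alpha a) a Hal ltac:(lra)) as K7.
pose proof (inv_slope_decr alpha (orb2 alpha a) a Hal ltac:(lra)) as K2.
pose proof (inv_slope_pos alpha a0 ltac:(lra)) as K0.
set (k0 := inv_slope alpha a0) in *. set (ka := inv_slope alpha a) in *.
set (k7 := inv_slope alpha (orb7 alpha a)) in *.
set (k2 := inv_slope alpha (orb2 alpha a)) in *.
set (x4 := orb4 alpha a) in *. clearbody k0 ka k7 k2 x4.
replace (a - (a - x4)) with x4 in C7 by ring.
assert (D7 : k0 * x4 <= orb7 alpha a - orb3 alpha a).
{ apply Rle_trans with (2 := C7). apply Rmult_le_compat_r; lra. }
assert (D2 : k0 * (k0 * x4) <= orb2 alpha a - orb6 alpha a).
{ apply Rle_trans with (2 := C2). apply Rmult_le_compat; try lra.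
  apply Rmult_le_pos; lra. }
assert (Da : ka * (Rpower a alpha - (a + orb6 alpha a)) < ka * (k0 * (k0 * x4))).
{ apply Rle_lt_trans with e; [lra|]. apply Rlt_le_trans with (1 := Hlt).
  replace (k0 * k0 * k0 * x4) with (k0 * (k0 * (k0 * x4))) by ring.
  apply Rmult_le_compat_r; [|assumption]. repeat apply Rmult_le_pos; lra. }
apply Rmult_lt_reg_l in Da; lra.
Qed.

(** Two uses of the intermediate value theorem: the first finds [a2] in the domain at gap [e] from
    its boundary, where [orb1] exceeds the parameter; the second runs from [a2] to [a0], where
    [orb1] is below it. *)
Lemma orb1_fixed_exists (alpha : R) :
  1 < alpha -> exists a, 1 < a /\ orb5 alpha a < a /\ orb1 alpha a = a.
Proof.
intros Hal. destruct (large_parameter alpha Hal) as [a0 [Ha0 [H50 H10]]].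
destruct (orb5_gt_near_1 alpha a0 Hal Ha0) as [a1 [Ha1 H51]].
pose proof (inv_slope_pos alpha a0 ltac:(lra)) as K0.
destruct (lt_scaled_root (/ alpha)
  (inv_slope alpha a0 * inv_slope alpha a0 * inv_slope alpha a0)
  (a0 - orb5 alpha a0)) as [e [He Hlt]].
{ now apply inv_lt_1. }
{ now repeat (apply Rmult_lt_0_compat; [|assumption]). }
{ lra. }
destruct (IVT_interv (fun z => z - orb5 alpha z - e) a1 a0) as [a2 [Ha2 E2]];
  try lra.
{ intros z Hz. apply (continuity_pt_minus (fun z => z - orb5 alpha z) (fun _ => e)).
  - eapply derivable_pt_lim_continuity, derivable_pt_lim_id_minus,
      derivable_pt_lim_orb5; lra.
  - apply continuity_pt_const. intros x y. reflexivity. }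
assert (H12 : a2 < orb1 alpha a2).
{ apply orb1_gt_near_boundary with a0 e; try assumption; lra. }
assert (Ha20 : a2 <> a0) by (intros ->; lra).
destruct (IVT_interv (fun z => z - orb1 alpha z) a2 a0) as [a [Ha E]]; try lra.
{ intros z Hz. eapply derivable_pt_lim_continuity, derivable_pt_lim_id_minus,
    derivable_pt_lim_orb1; try lra.
  apply orb5_lt_upward with a2; lra. }
exists a. split; [lra|]. split; [|lra]. apply orb5_lt_upward with a2; lra.
Qed.

Lemma f_0 (alpha a : R) : Defs.f alpha a 0 = a.
Proof.
unfold Defs.f, abs_pow. destruct (Req_EM_T 0 0); lra.
Qed.

Lemma f_pos (alpha a x : R) : 0 < x -> Defs.f alpha a x = a - Rpower x alpha.
Proof.
intros Hx. unfold Defs.f, abs_pow. destruct (Req_EM_T x 0); [lra|].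
rewrite Rabs_pos_eq; lra.
Qed.

Lemma f_neg (alpha a x : R) : x < 0 -> Defs.f alpha a x = a - Rpower (- x) alpha.
Proof.
intros Hx. unfold Defs.f, abs_pow. destruct (Req_EM_T x 0); [lra|].
rewrite Rabs_left; lra.
Qed.

Lemma root_of_image (alpha a x y : R) :
  0 < alpha -> 0 < x -> a - Rpower x alpha = y -> Rpower (a - y) (/ alpha) = x.
Proof.
intros Hal Hx <-. replace (a - (a - Rpower x alpha)) with (Rpower x alpha) by ring.
now apply RpowerK_inv.
Qed.

(** Each symbol selects an inverse branch of [f], so the orbit is recovered from its end [x8 = 0];
    the pullback must then return to the critical value [a]. *)
Lemma kneading_orb (alpha a : R) :
  1 < alpha ->
  kneading_RLRRRLRC alpha a <-> 1 < a /\ orb5 alpha a < a /\ orb1 alpha a = a.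
Proof.
intros Hal. split.
- unfold kneading_RLRRRLRC. cbn [iter_f]. rewrite f_0.
  set (x2 := Defs.f alpha a a). set (x3 := Defs.f alpha a x2). set (x4 := Defs.f alpha a x3).
  set (x5 := Defs.f alpha a x4). set (x6 := Defs.f alpha a x5). set (x7 := Defs.f alpha a x6).
  intros [H1 [H2 [H3 [H4 [H5 [H6 [H7 H8]]]]]]].
  assert (E7 : orb7 alpha a = x7).
  { rewrite f_pos in H8 by lra. unfold orb7. rewrite <- (Rminus_0_r a).
    apply root_of_image; lra. }
  assert (E6 : orb6 alpha a = - x6).
  { unfold orb6. rewrite E7. apply root_of_image; try lra.
    symmetry. apply f_neg. lra. }
  assert (E5 : orb5 alpha a = x5).
  { unfold orb5. rewrite E6. apply root_of_image; try lra.
    symmetry. apply f_pos. lra. }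
  assert (E4 : orb4 alpha a = x4).
  { unfold orb4. rewrite E5. apply root_of_image; try lra.
    symmetry. apply f_pos. lra. }
  assert (E3 : orb3 alpha a = x3).
  { unfold orb3. rewrite E4. apply root_of_image; try lra.
    symmetry. apply f_pos. lra. }
  assert (E2 : orb2 alpha a = - x2).
  { unfold orb2. rewrite E3. apply root_of_image; try lra.
    symmetry. apply f_neg. lra. }
  assert (E1 : orb1 alpha a = a).
  { unfold orb1. rewrite E2. apply root_of_image; try lra.
    symmetry. apply f_pos. lra. }
  split; [|split; [|assumption]].
  (* The sign [x2 < 0] says [a < a^alpha], which fails for [0 < a <= 1]. *)
  + unfold x2 in H2. rewrite f_pos in H2 by assumption.
    apply Rnot_le_lt. intros Hle.
    pose proof (Rle_Rpower_l a 1 (alpha - 1) ltac:(lra) ltac:(lra)) as H.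
    rewrite Rpower_1_base in H.
    rewrite Rpower_pred in H by assumption.
    apply (Rmult_le_compat_r a) in H; [|lra].
    replace (Rpower a alpha / a * a) with (Rpower a alpha) in H by (field; lra). lra.
  + rewrite E5. assert (E : x5 = a - Rpower x4 alpha) by (apply f_pos; lra).
    rewrite E. pose proof (Rpower_pos x4 alpha). lra.
- intros [Ha [H5 H1]].
  destruct (orb765_pow alpha a Hal Ha) as [E7 [E6 E5]].
  destruct (orb4321_pow alpha a Hal Ha H5) as [E4 [E3 [E2 E1]]].
  rewrite H1 in E1.
  assert (P7 : 0 < orb7 alpha a) by apply Rpower_pos.
  assert (P6 : 0 < orb6 alpha a) by apply Rpower_pos.
  assert (P5 : 0 < orb5 alpha a) by apply Rpower_pos.
  assert (P4 : 0 < orb4 alpha a) by apply Rpower_pos.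
  assert (P3 : 0 < orb3 alpha a) by apply Rpower_pos.
  assert (P2 : 0 < orb2 alpha a) by apply Rpower_pos.
  assert (F1 : Defs.f alpha a a = - orb2 alpha a) by (rewrite f_pos; lra).
  assert (F2 : Defs.f alpha a (- orb2 alpha a) = orb3 alpha a)
    by (rewrite f_neg, Ropp_involutive; lra).
  assert (F3 : Defs.f alpha a (orb3 alpha a) = orb4 alpha a) by (rewrite f_pos; lra).
  assert (F4 : Defs.f alpha a (orb4 alpha a) = orb5 alpha a) by (rewrite f_pos; lra).
  assert (F5 : Defs.f alpha a (orb5 alpha a) = - orb6 alpha a) by (rewrite f_pos; lra).
  assert (F6 : Defs.f alpha a (- orb6 alpha a) = orb7 alpha a)
    by (rewrite f_neg, Ropp_involutive; lra).
  assert (F7 : Defs.f alpha a (orb7 alpha a) = 0) by (rewrite f_pos; lra).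
  unfold kneading_RLRRRLRC. cbn [iter_f].
  rewrite f_0, F1, F2, F3, F4, F5, F6, F7. repeat split; lra.
Qed.

Theorem theorem4p1 (alpha : R) (Halpha : 1 < alpha) :
  exists a : R, kneading_RLRRRLRC alpha a /\
    forall b : R, kneading_RLRRRLRC alpha b -> b = a.
Proof.
destruct (orb1_fixed_exists alpha Halpha) as [a Ha].
exists a. split; [now apply kneading_orb|].
intros b Hb. apply kneading_orb in Hb; [|assumption].
destruct Ha as [Ha [Ha5 Ha1]]. destruct Hb as [Hb [Hb5 Hb1]].
(* Of two distinct fixed points, the larger would lie strictly above its own [orb1]. *)
destruct (Rtotal_order a b) as [Hlt|[E|Hgt]]; [|congruence|].
- pose proof (orb1_lt_after_fixed alpha a b Halpha ltac:(lra) Ha5 Ha1). lra.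
- pose proof (orb1_lt_after_fixed alpha b a Halpha ltac:(lra) Hb5 Hb1). lra.
Qed.
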